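(* Let $k$ be a field. (a) Let $A$ be an algebra over $k$ and $M$ an $A$-module. Assume that $A$ has a sequence of subalgebras $A_1,A_2,\dots,A_n,\dots$ and that $M$ has a sequence of $k$-subspaces $M_1,M_2,\dots,M_n,\dots$ such that $M$ is the union of all $M_i$ and for any positive integers $i,j$ there exists a positive integer $r$ such that $M_i$ and $M_j$ are contained in $M_r$. If $M_i$ is an irreducible $A_i$-submodule of $M$ for every $i$, then $M$ is an irreducible $A$-module. (b) Let $G$ be a group and $M$ a $kG$-module. Assume that $G$ has a sequence of subgroups $G_1,G_2,\dots,G_n,\dots$ and that $M$ has a sequence of $k$-subspaces $M_1,M_2,\dots,M_n,\dots$ such that $M$ is the union of all $M_i$ and for any positive integers $i,j$ there exists an integer $r$ such that $M_i$ and $M_j$ are contained in $M_r$. If $M_i$ is an irreducible $G_i$-submodule of $M$ for every $i$, then $M$ is an irreducible $G$-module.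
   Context: Modules are over the field $k$; a $G$-module is a $kG$-module, and ''$M_i$ is an irreducible $A_i$-submodule of $M$'' means that the subspace $M_i$ is stable under $A_i$ and irreducible as an $A_i$-module. *)

(* Defs.v *)
From HB Require Import structures.
From mathcomp Require Import all_boot all_algebra.
From mathcomp Require Import finmap.
From mathcomp.multinomials Require Import monalg.
From mathcomp Require Import boolp classical_sets.

Set Implicit Arguments.
Unset Strict Implicit.
Unset Printing Implicit Defensive.

Import GRing.Theory.

Local Open Scope ring_scope.
Local Open Scope classical_set_scope.

(* The convolution ring that [monalg] puts on [{malg R[K]}] needs a [monomType]
   [K], where [x * y = 1] forces [x = y = 1]; hence an alias of the free module
   [{malg R[G]}] for the group algebra, with its own product. *)
Definition grpalg (R : comNzRingType) (G : groupType) : Type := {malg R[G]}.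

Section GroupAlgebra.
Context (R : comNzRingType) (G : groupType).
Local Notation RG := (grpalg R G).

HB.instance Definition _ := GRing.Lmodule.copy RG {malg R[G]}.

Definition gaone : RG := << 1%g >>.

Definition gamul (a b : RG) : RG :=
  \sum_(g <- msupp a) \sum_(h <- msupp b) << a@_g * b@_h *g (g * h)%g >>.

Lemma gamulE (d1 d2 : {fset G}) (a b : RG) :
  (msupp a `<=` d1)%fset -> (msupp b `<=` d2)%fset ->
  gamul a b = \sum_(g <- d1) \sum_(h <- d2) << a@_g * b@_h *g (g * h)%g >>.
Proof.
move=> le1 le2; rewrite /gamul (big_fset_incl _ le1) /=.
  apply: eq_bigr => g _; apply: big_fset_incl => // h _ /mcoeff_outdom ->.
  by rewrite mulr0 monalgU0.
move=> g _ /mcoeff_outdom ag.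
by rewrite big1 // => h _; rewrite ag mul0r monalgU0.
Qed.

Lemma gamulDl : left_distributive gamul +%R.
Proof.
move=> a b c.
rewrite (gamulE (msuppD_le a b) (fsubset_refl (msupp c))).
rewrite (gamulE (fsubsetUl (msupp a) (msupp b)) (fsubset_refl (msupp c))).
rewrite (gamulE (fsubsetUr (msupp a) (msupp b)) (fsubset_refl (msupp c))).
rewrite -big_split /=; apply: eq_bigr => g _.
rewrite -big_split /=; apply: eq_bigr => h _.
by rewrite mcoeffD mulrDl monalgUD.
Qed.

Lemma gamulDr : right_distributive gamul +%R.
Proof.
move=> c a b.
rewrite (gamulE (fsubset_refl (msupp c)) (msuppD_le a b)).
rewrite (gamulE (fsubset_refl (msupp c)) (fsubsetUl (msupp a) (msupp b))).
rewrite (gamulE (fsubset_refl (msupp c)) (fsubsetUr (msupp a) (msupp b))).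
rewrite -big_split /=; apply: eq_bigr => g _.
rewrite -big_split /=; apply: eq_bigr => h _.
by rewrite mcoeffD mulrDr monalgUD.
Qed.

Lemma gamul0g : left_zero 0 gamul.
Proof.
move=> a.
by rewrite (gamulE (d1 := fset0) _ (fsubset_refl _)) ?msupp0 ?big_seq_fset0.
Qed.

Lemma gamulg0 : right_zero 0 gamul.
Proof.
move=> a; rewrite (gamulE (d2 := fset0) (fsubset_refl _)) ?msupp0 //.
by rewrite big1 // => g _; rewrite big_seq_fset0.
Qed.

Lemma gamulUU (c d : R) (g h : G) :
  gamul << c *g g >> << d *g h >> = << c * d *g (g * h)%g >>.
Proof. by rewrite (gamulE msuppU_le msuppU_le) !big_seq_fset1 !mcoeffUU. Qed.

Lemma gamul_suml I (s : seq I) (F : I -> RG) (b : RG) :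
  gamul (\sum_(i <- s) F i) b = \sum_(i <- s) gamul (F i) b.
Proof. exact: (big_morph (gamul^~ b) (fun x y => gamulDl x y b) (gamul0g b)). Qed.

Lemma gamul_sumr I (s : seq I) (F : I -> RG) (a : RG) :
  gamul a (\sum_(i <- s) F i) = \sum_(i <- s) gamul a (F i).
Proof. exact: (big_morph (gamul a) (gamulDr a) (gamulg0 a)). Qed.

Lemma gamulEl (a b : RG) :
  gamul a b = \sum_(g <- msupp a) gamul << a@_g *g g >> b.
Proof. by rewrite {1}(monalgE a) (gamul_suml (msupp a)). Qed.

Lemma gamulEr (a b : RG) :
  gamul a b = \sum_(h <- msupp b) gamul a << b@_h *g h >>.
Proof. by rewrite {1}(monalgE b) (gamul_sumr (msupp b)). Qed.

Lemma gamulA : associative gamul.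
Proof.
move=> a b c.
rewrite (gamulEl a (gamul b c)) (gamulEl a b) (gamul_suml (msupp a)).
apply: eq_bigr => g _; rewrite (gamulEl b c) (gamulEr << a@_g *g g >> b).
rewrite (gamul_suml (msupp b)) (gamul_sumr (msupp b)).
apply: eq_bigr => h _; rewrite (gamulEr << b@_h *g h >> c).
rewrite (gamulEr (gamul _ _) c) (gamul_sumr (msupp c)).
by apply: eq_bigr => i _; rewrite !gamulUU mulrA mulgA.
Qed.

Lemma gamul1g : left_id gaone gamul.
Proof.
move=> a; rewrite gamulEr [RHS]monalgE.
by apply: eq_bigr => g _; rewrite gamulUU mul1r mul1g.
Qed.

Lemma gamulg1 : right_id gaone gamul.
Proof.
move=> a; rewrite gamulEl [RHS]monalgE.
by apply: eq_bigr => g _; rewrite gamulUU mulr1 mulg1.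
Qed.

Lemma gaone_neq0 : gaone != 0.
Proof. by rewrite /gaone monalgU_eq0 oner_eq0. Qed.

HB.instance Definition _ := GRing.Zmodule_isNzRing.Build RG
  gamulA gamul1g gamulg1 gamulDl gamulDr gaone_neq0.

Lemma gascaleE (c : R) (a : RG) : c *: a = (<< c *g 1%g >> : RG) * a.
Proof.
rewrite [RHS]gamulEr; apply/malgP => g; rewrite mcoeffZ {1}(monalgE a).
rewrite !raddf_sum mulr_sumr; apply: eq_bigr => h _ /=.
by rewrite gamulUU mul1g !mcoeffU mulrnAr.
Qed.

Lemma gascaleAl (c : R) (a b : RG) : c *: (a * b) = (c *: a) * b.
Proof. by rewrite !gascaleE mulrA. Qed.

HB.instance Definition _ := GRing.Lmodule_isLalgebra.Build R RG gascaleAl.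

Lemma gascaleAr (c : R) (a b : RG) : c *: (a * b) = a * (c *: b).
Proof.
suff caC : (<< c *g 1%g >> : RG) * a = a * (<< c *g 1%g >> : RG).
  by rewrite !gascaleE mulrA caC mulrA.
rewrite [LHS]gamulEr [RHS]gamulEl; apply: eq_bigr => g _.
by rewrite !gamulUU mul1g mulg1 mulrC.
Qed.

HB.instance Definition _ := GRing.Lalgebra_isAlgebra.Build R RG gascaleAr.

(* The group algebra of [H], as a subset of that of [G]. *)
Definition grpalg_on (H : set G) : set RG :=
  [set a | forall g, a@_g != 0 -> H g].

Lemma grpalg_on_subalg (H : set G) :
  group_closed (mem H) -> subalg_closed (mem (grpalg_on H)).
Proof.
move=> [H1 HV]; have HM := group_closedM (conj H1 HV).
split.
- rewrite inE => g; rewrite mcoeffU; case: (eqVneq 1%g g) => [<- _|_] /=.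
    by rewrite inE in H1.
  by rewrite eqxx.
- move=> c a b; rewrite !inE => Ha Hb g.
  have [a0 | /Ha //] := eqVneq (a@_g) 0.
  by rewrite mcoeffD mcoeffZ a0 mulr0 add0r => /Hb.
- move=> a b; rewrite !inE => Ha Hb x; apply: contraNP => Hx.
  rewrite raddf_sum big_seq big1 // => g ga /=.
  rewrite raddf_sum big_seq big1 // => h hb /=.
  rewrite mcoeffU; case: (eqVneq (g * h)%g x) => // E; exfalso; apply: Hx.
  rewrite -E; have := HM g h; rewrite !inE; apply.
    by apply: Ha; rewrite mcoeff_neq0.
  by apply: Hb; rewrite mcoeff_neq0.
Qed.

End GroupAlgebra.

Section Irreducibility.
Context (k : fieldType) (A : algType k) (M : lmodType A).
Implicit Types (B : set A) (N L : set M).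

(* [k] acts on the [A]-module [M] through [c |-> c%:A]. *)
Definition ksubspace N : Prop :=
  [/\ N 0, forall x y, N x -> N y -> N (x + y)
    & forall (c : k) x, N x -> N (c%:A *: x)].

Definition submodule_over B N : Prop :=
  ksubspace N /\ forall b x, B b -> N x -> N (b *: x).

Definition irreducible_submodule B N : Prop :=
  [/\ submodule_over B N, N <> [set 0]
    & forall L, submodule_over B L -> L `<=` N -> L = [set 0] \/ L = N].

Definition irreducible_module : Prop :=
  [set: M] <> [set 0] /\
  forall N, submod_closed (mem N) -> N = [set 0] \/ N = [set: M].

End Irreducibility.

Arguments irreducible_module {k A} M.

(* Main.v *)
Require Import Defs.
From mathcomp Require Import all_boot all_algebra.
From mathcomp Require Import boolp classical_sets.

Import GRing.Theory.
Local Open Scope ring_scope.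
Local Open Scope classical_set_scope.

(** A submodule [N] of [M] meets each [M_ r] in an [A_ r]-submodule, which is zero or all of [M_ r].
    If [N] is nonzero, the choice of [r] excludes zero, so [N] reaches every vector. Both parts of
    the theorem are instances of this one argument. *)

(* Directedness puts a nonzero vector of the submodule [N] and an arbitrary
   vector of [M] into a common [M_ r]; irreducibility of [M_ r] then forces
   [N] to contain all of [M_ r]. *)
Lemma directed_union_irreducible (k : fieldType) (A : algType k) (M : lmodType A)
    (I : pointedType) (A_ : I -> set A) (M_ : I -> set M) :
  [set: M] = \bigcup_i M_ i ->
  (forall i j, exists r, M_ i `<=` M_ r /\ M_ j `<=` M_ r) ->
  (forall i, irreducible_submodule (A_ i) (M_ i)) ->
  irreducible_module M.
Proof.
move=> Mcup Mdir Mirr; split=> [M0 | N [N0 NL]].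
  (* If [M] were zero, so would be its subspace at [point], against irreducibility; the pointed
     index type supplies that index. *)
  have [[[Mi0 _ _] _] + _] := Mirr point; apply.
  apply/seteqP; split=> [x _|_ -> //].
  by rewrite -M0.
have {N0} N0 : N 0 by rewrite inE in N0.
have {}NL a x y : N x -> N y -> N (a *: x + y).
  by move=> Nx Ny; apply/set_mem/NL; apply/mem_set.
have NZ a x : N x -> N (a *: x) by move=> Nx; rewrite -[_ *: _]addr0; apply: NL.
have [[x [Nx /eqP x0]]|NN] := pselect (exists x, N x /\ x <> 0); last first.
  left; apply/seteqP; split=> [x Nx|_ -> //].
  by apply: contrapT => x0; apply: NN; exists x.
right; apply/seteqP; split=> // y _.
have inM z : exists i, M_ i z.
  have : [set: M] z by [].
  by rewrite Mcup => -[i _ Mz]; exists i.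
have [[i Mix] [j Mjy]] := (inM x, inM y).
have [r [ir jr]] := Mdir i j.
have [[[Mr0 MrD MrZ] MrA] _ Mrmin] := Mirr r.
(* [N] is stable under all of [A], hence under [A_ r] and under the scalars [c%:A] through which [k]
   acts. *)
have subNM : submodule_over (A_ r) (N `&` M_ r).
  split; last by move=> b u Ab [Nu Mu]; split; [exact: NZ | exact: MrA].
  split=> [//|u v [Nu Mu] [Nv Mv]|c u [Nu Mu]].
    by split; [rewrite -[u]scale1r; apply: NL | exact: MrD].
  by split; [exact: NZ | exact: MrZ].
have [NM0|NMr] := Mrmin _ subNM (@subIsetr _ _ _).
  have : (N `&` M_ r) x by split=> //; apply: ir.
  by rewrite NM0 => /eqP; rewrite (negPf x0).
by have [] : (N `&` M_ r) y by rewrite NMr; apply: jr.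
Qed.

Theorem lemma1p6 (k : fieldType) :
  (forall (A : algType k) (M : lmodType A)
      (A_ : nat -> set A) (M_ : nat -> set M),
    (forall i, subalg_closed (mem (A_ i))) ->
    (forall i, ksubspace (M_ i)) ->
    [set: M] = \bigcup_i M_ i ->
    (forall i j, exists r, M_ i `<=` M_ r /\ M_ j `<=` M_ r) ->
    (forall i, irreducible_submodule (A_ i) (M_ i)) ->
    irreducible_module M)
  /\
  (forall (G : groupType) (M : lmodType (grpalg k G))
      (G_ : nat -> set G) (M_ : nat -> set M),
    (forall i, group_closed (mem (G_ i))) ->
    (forall i, ksubspace (M_ i)) ->
    [set: M] = \bigcup_i M_ i ->
    (forall i j, exists r, M_ i `<=` M_ r /\ M_ j `<=` M_ r) ->
    (forall i, irreducible_submodule (grpalg_on (G_ i)) (M_ i)) ->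
    irreducible_module M).
Proof.
(* For groups, take the algebra [grpalg k G] and the subsets [grpalg_on (G_ i)]. *)
by split=> [A M A_ M_ _ _|G M G_ M_ _ _]; apply: directed_union_irreducible.
Qed.
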